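(* For $n \ge 1$ let $$B_n = \sum_{k = 1}^{n} \frac{2}{n(n + 1)^{2}} \binom{n+1}{k-1} \binom{n+1}{k} \binom{n+1}{k+1}$$ be the Baxter numbers. Then the sequences $\left(\sqrt[n]{B_n}/n!\right)_{n \ge 2}$ and $\left(\sqrt[n+1]{B_{n+1}}/(\sqrt[n]{B_n}\, n!)\right)_{n \ge 2}$ both satisfy the higher order Turán inequality.
   Context: A sequence $(c_n)_{n \ge m}$ of real numbers satisfies the higher order Turán inequality if for all $n \ge m+1$, $$4(c_{n}^2 - c_{n-1}c_{n+1})(c_{n+1}^2 - c_{n}c_{n+2}) - (c_{n}c_{n+1} - c_{n-1}c_{n+2})^2 \ge 0.$$ *)

(* Defs.v *)
From Stdlib Require Import Reals.
Open Scope R_scope.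

(** The value of [c] below [m] is irrelevant: the inequality at [n >= m+1]
    only involves [c (n-1)], ..., [c (n+2)], and there [n - 1] is not truncated. *)
Definition higher_order_Turan (m : nat) (c : nat -> R) : Prop :=
  forall n : nat, (n >= m + 1)%nat ->
    4 * (c n ^ 2 - c (n - 1)%nat * c (n + 1)%nat)
      * (c (n + 1)%nat ^ 2 - c n * c (n + 2)%nat)
    - (c n * c (n + 1)%nat - c (n - 1)%nat * c (n + 2)%nat) ^ 2 >= 0.

(** Meaningful for [n >= 1].  The summation index satisfies [1 <= k <= n], so
    [k - 1] is not truncated and every binomial [C (n+1) j] has [j <= n+1]
    (the library's [C] is not zero beyond that range). *)
Definition Baxter (n : nat) : R :=
  sum_f 1 n (fun k : nat =>
    2 / (INR n * INR (n + 1) ^ 2)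
      * Binomial.C (n + 1) (k - 1) * Binomial.C (n + 1) k
      * Binomial.C (n + 1) (k + 1)).

(** The positive [n]-th root, for [n >= 1] and [x > 0]; [Rpower x y] is
    [exp (y * ln x)], which is not the root at [x = 0]. *)
Definition nth_root (n : nat) (x : R) : R := Rpower x (/ INR n).

(* Main.v *)
(* A sequence with quotients [u_n = c_(n-1) c_(n+1) / c_n^2] satisfies the higher
   order Turan inequality iff [4 (1 - u_n) (1 - u_(n+1)) >= (1 - u_n u_(n+1))^2].
   The factorials contribute [n / (n + 1)] to [u_n], and that alone gives a gap
   of order [4 / n^3]; the roots contribute [exp d_n] (resp.
   [exp (d_(n+1) - d_n)]), where [d_n] is the second difference of
   [ln B_n / n].  A perturbation of size [C / n^2] changes the gap only by
   [O(1 / n^4)], so it suffices to bound [d_n] roughly.  The three-term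
   recurrence of the Baxter numbers (creative telescoping) yields
   [8 n / (n + 4) <= B_(n+1) / B_n <= 8 (n + 1) / (n + 5)] by induction, and
   these bounds give [|d_n| <= 3.1 / n^2] for [n >= 40].  The indices below 40
   are decided by exact arithmetic on rational enclosures of the roots. *)

Require Import Defs.
From Stdlib Require Import Reals Factorial Lra Lia List ZArith QArith Qreals.
Import ListNotations.
Open Scope R_scope.

(** * The three-term recurrence by creative telescoping *)

Definition baxter_term (m i : nat) : R :=
  / (INR (fact i) * INR (fact (i + 1)) * INR (fact (i + 2))
     * INR (fact (m + 1 - i)) * INR (fact (m - i)) * INR (fact (m - 1 - i))).

(** With [k = i + 1], each of the three binomials contributes a factor [(m + 1)!]; what is left is
    [baxter_term m i], whose dependence on [m] sits only in three factorials. *)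
Lemma Baxter_sum_term (m : nat) : (1 <= m)%nat ->
  Baxter m * (INR m * INR (m + 1) ^ 2)
  = 2 * INR (fact (m + 1)) ^ 3 * sum_f_R0 (baxter_term m) (m - 1).
Proof.
  intros Hm.
  assert (Hm0 : INR m <> 0) by (apply not_0_INR; lia).
  assert (Hm1 : INR (m + 1) <> 0) by (apply not_0_INR; lia).
  unfold Baxter, sum_f.
  rewrite Rmult_comm, !scal_sum.
  apply sum_eq; intros i Hi.
  unfold Binomial.C, baxter_term.
  replace (i + 1 - 1)%nat with i by lia.
  replace (i + 1 + 1)%nat with (i + 2)%nat by lia.
  replace (m + 1 - (i + 1))%nat with (m - i)%nat by lia.
  replace (m + 1 - (i + 2))%nat with (m - 1 - i)%nat by lia.
  field.
  repeat split; try apply INR_fact_neq_0; assumption.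
Qed.

Lemma INR_fact_succ (n : nat) : INR (fact (S n)) = (INR n + 1) * INR (fact n).
Proof. now rewrite fact_simpl, mult_INR, S_INR. Qed.

(* The certificate polynomial found by Zeilberger's algorithm. *)
Definition certificate (n i : R) : R :=
  - (118 + 181 * n + 89 * n ^ 2 + 14 * n ^ 3)
  + (110 + 111 * n + 27 * n ^ 2) * i - (36 + 18 * n) * i ^ 2 + 4 * i ^ 3.

(** In terms of [t = N - i], the terms for [n + 1] and [n] are [baxter_term (n + 2) i] times
    [(t+3)(t+2)(t+1)] and [(t+3)(t+2)^2(t+1)^2 t], so the summand is the recurrence operator applied
    to the terms. Induction on [K] then checks the closed form of its partial sums. *)
Lemma baxter_term_telescope (n K : nat) : (K <= n + 1)%nat ->
  let N := INR n in
  sum_f_R0 (fun i =>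
    let t := N - INR i in
    ((N + 1) * (N + 2) ^ 2 * (N + 3) * (N + 4) * (N + 5)
     - (7 * N ^ 2 + 35 * N + 40) * (N + 2) * ((t + 3) * (t + 2) * (t + 1))
     - 8 * ((t + 3) * (t + 2) ^ 2 * (t + 1) ^ 2 * t))
    * baxter_term (n + 2) i) K
  = (N + 3 - INR K) * (N + 2 - INR K) * (N + 1 - INR K)
    * certificate N (INR K + 1) * baxter_term (n + 2) K.
Proof.
  intros HK N.
  induction K as [|K IH].
  - cbn [sum_f_R0]. unfold certificate. simpl INR. ring.
  - rewrite tech5, IH by lia.
    (* The ratio of two consecutive terms. Writing [n = j + K] turns every truncated subtraction
       into an explicit successor. *)
    assert (Hshift : (N + 3 - INR K) * (N + 2 - INR K) * (N + 1 - INR K)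
              * baxter_term (n + 2) K
            = (INR K + 1) * (INR K + 2) * (INR K + 3)
              * baxter_term (n + 2) (S K)).
    { destruct (Nat.le_exists_sub K n ltac:(lia)) as [j [Hj _]].
      unfold baxter_term, N. rewrite Hj.
      replace (j + K + 2 + 1 - K)%nat with (S (S (S j))) by lia.
      replace (j + K + 2 - K)%nat with (S (S j)) by lia.
      replace (j + K + 2 - 1 - K)%nat with (S j) by lia.
      replace (j + K + 2 + 1 - S K)%nat with (S (S j)) by lia.
      replace (j + K + 2 - S K)%nat with (S j) by lia.
      replace (j + K + 2 - 1 - S K)%nat with j by lia.
      replace (S K + 1)%nat with (S (S K)) by lia.
      replace (S K + 2)%nat with (S (S (S K))) by lia.
      replace (K + 1)%nat with (S K) by lia.
      replace (K + 2)%nat with (S (S K)) by lia.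
      rewrite !INR_fact_succ, plus_INR, !S_INR.
      pose proof (pos_INR K). pose proof (pos_INR j).
      field. repeat split; try apply INR_fact_neq_0; lra. }
    replace ((N + 3 - INR K) * (N + 2 - INR K) * (N + 1 - INR K) *
       certificate N (INR K + 1) * baxter_term (n + 2) K)
    with ((INR K + 1) * (INR K + 2) * (INR K + 3)
              * baxter_term (n + 2) (S K) * certificate N (INR K + 1))
      by (rewrite <- Hshift; ring).
    unfold certificate. rewrite S_INR. ring.
Qed.

(** Brings sums of different lengths to a common range. Beyond its range [baxter_term] is not zero,
    because its subtractions truncate; the polynomial multiples [g] do vanish there. *)
Lemma sum_f_R0_extend (f g : nat -> R) (K d : nat) :
  (forall i : nat, (i <= K)%nat -> f i = g i) ->
  (forall i : nat, (K < i <= K + d)%nat -> g i = 0) ->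
  sum_f_R0 f K = sum_f_R0 g (K + d).
Proof.
  intros Heq H0. rewrite (sum_eq f g K Heq). clear Heq.
  induction d as [|d IH]; [now rewrite Nat.add_0_r|].
  rewrite Nat.add_succ_r, tech5, <- IH, H0 by (intros; try apply H0; lia).
  ring.
Qed.

Theorem Baxter_recurrence (n : nat) : (1 <= n)%nat ->
  (INR n + 4) * (INR n + 5) * Baxter (n + 2)
  = (7 * INR n ^ 2 + 35 * INR n + 40) * Baxter (n + 1)
    + 8 * INR n * (INR n + 1) * Baxter n.
Proof.
  intros Hn.
  (* At [K = n + 1] the factor [N + 1 - K] on the right is zero, so the whole sum vanishes. *)
  pose proof (baxter_term_telescope n (n + 1) (le_n _)) as Htel.
  cbv beta zeta in Htel. set (N := INR n) in *.
  pose proof (le_INR 1 n Hn) as HN. simpl INR in HN. fold N in HN.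
  assert (E0 : sum_f_R0 (baxter_term n) (n - 1)
    = sum_f_R0 (fun i => (N - INR i + 3) * (N - INR i + 2) ^ 2
        * (N - INR i + 1) ^ 2 * (N - INR i) * baxter_term (n + 2) i) (n + 1)).
  { replace (n + 1)%nat with (n - 1 + 2)%nat by lia.
    apply sum_f_R0_extend; intros i Hi.
    - destruct (Nat.le_exists_sub (S i) n ltac:(lia)) as [j [Hj _]].
      unfold baxter_term, N. rewrite Hj.
      replace (j + S i + 1 - i)%nat with (S (S j)) by lia.
      replace (j + S i - i)%nat with (S j) by lia.
      replace (j + S i - 1 - i)%nat with j by lia.
      replace (j + S i + 2 + 1 - i)%nat with (S (S (S (S j)))) by lia.
      replace (j + S i + 2 - i)%nat with (S (S (S j))) by lia.
      replace (j + S i + 2 - 1 - i)%nat with (S (S j)) by lia.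
      rewrite !INR_fact_succ, plus_INR, !S_INR.
      pose proof (pos_INR j).
      field. repeat split; try apply INR_fact_neq_0; lra.
    (* The factor [N - i] vanishes at [i = n], and [N - i + 1] at [i = n + 1]. *)
    - assert (Hor : i = n \/ i = S n) by lia.
      destruct Hor as [-> | ->]; rewrite ?S_INR; fold N; ring. }
  assert (E1 : sum_f_R0 (baxter_term (n + 1)) n
    = sum_f_R0 (fun i => (N - INR i + 3) * (N - INR i + 2)
        * (N - INR i + 1) * baxter_term (n + 2) i) (n + 1)).
  { apply sum_f_R0_extend; intros i Hi.
    - destruct (Nat.le_exists_sub i n ltac:(lia)) as [j [Hj _]].
      unfold baxter_term, N. rewrite Hj.
      replace (j + i + 1 + 1 - i)%nat with (S (S j)) by lia.
      replace (j + i + 1 - i)%nat with (S j) by lia.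
      replace (j + i + 1 - 1 - i)%nat with j by lia.
      replace (j + i + 2 + 1 - i)%nat with (S (S (S j))) by lia.
      replace (j + i + 2 - i)%nat with (S (S j)) by lia.
      replace (j + i + 2 - 1 - i)%nat with (S j) by lia.
      rewrite !INR_fact_succ, plus_INR, !S_INR.
      pose proof (pos_INR j).
      field. repeat split; try apply INR_fact_neq_0; lra.
    - replace i with (S n) by lia. rewrite S_INR. fold N. ring. }
  pose proof (Baxter_sum_term n Hn) as B0.
  pose proof (Baxter_sum_term (n + 1) ltac:(lia)) as B1.
  pose proof (Baxter_sum_term (n + 2) ltac:(lia)) as B2.
  replace (n + 1 - 1)%nat with n in B1 by lia.
  replace (n + 2 - 1)%nat with (n + 1)%nat in B2 by lia.
  rewrite E0 in B0. rewrite E1 in B1.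
  replace (n + 1 + 1)%nat with (S (S n)) in B1 by lia.
  replace (n + 2 + 1)%nat with (S (S (S n))) in B2 by lia.
  replace (n + 1)%nat with (S n) in B0, B1, B2, Htel |- * by lia.
  replace (n + 2)%nat with (S (S n)) in B0, B1, B2, Htel |- * by lia.
  rewrite !INR_fact_succ, !S_INR in B0. rewrite !INR_fact_succ, !S_INR in B1.
  rewrite !INR_fact_succ, !S_INR in B2. fold N in B0, B1, B2.
  rewrite (sum_eq _ (fun i =>
       baxter_term (S (S n)) i
         * ((N + 1) * (N + 2) ^ 2 * (N + 3) * (N + 4) * (N + 5))
     - ((N - INR i + 3) * (N - INR i + 2) * (N - INR i + 1)
          * baxter_term (S (S n)) i)
         * ((7 * N ^ 2 + 35 * N + 40) * (N + 2))
     - ((N - INR i + 3) * (N - INR i + 2) ^ 2 * (N - INR i + 1) ^ 2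
          * (N - INR i) * baxter_term (S (S n)) i) * 8)) in Htel
    by (intros; ring).
  rewrite !minus_sum, <- !scal_sum, S_INR in Htel. fold N in Htel.
  set (s0 := sum_f_R0 _ _) in B0.
  set (s1 := sum_f_R0 _ _) in B1.
  set (s2 := sum_f_R0 _ _) in B2.
  fold s0 s1 s2 in Htel.
  set (F := INR (fact n)) in *.
  assert (HF : F <> 0) by apply INR_fact_neq_0.
  assert (Hb0 : Baxter n = 2 * (N + 1) * F ^ 3 * s0 / N).
  { apply (Rmult_eq_reg_r (N * (N + 1) ^ 2)); [rewrite B0; field; lra|].
    apply Rgt_not_eq; nra. }
  assert (Hb1 : Baxter (S n) = 2 * (N + 1) ^ 2 * (N + 2) * F ^ 3 * s1).
  { apply (Rmult_eq_reg_r ((N + 1) * (N + 1 + 1) ^ 2)); [rewrite B1; ring|].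
    apply Rgt_not_eq; nra. }
  assert (Hb2 : Baxter (S (S n))
    = 2 * (N + 1) ^ 3 * (N + 2) ^ 2 * (N + 3) * F ^ 3 * s2).
  { apply (Rmult_eq_reg_r ((N + 1 + 1) * (N + 1 + 1 + 1) ^ 2));
      [rewrite B2; ring|].
    apply Rgt_not_eq; nra. }
  rewrite Hb0, Hb1, Hb2.
  apply Rminus_diag_uniq.
  (* Once the common factor is taken out, the recurrence is the combination of sums that [Htel]
     shows to be zero. *)
  transitivity (2 * (N + 1) ^ 2 * F ^ 3
    * ((N + 1) * (N + 2) ^ 2 * (N + 3) * (N + 4) * (N + 5) * s2
       - (7 * N ^ 2 + 35 * N + 40) * (N + 2) * s1 - 8 * s0)).
  - field. lra.
  - rewrite Htel. ring.
Qed.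

(** * Growth of the Baxter numbers and of their logarithms *)

Lemma Baxter_1 : Baxter 1 = 1.
Proof. unfold Baxter, sum_f, Binomial.C; simpl; field. Qed.

Lemma Baxter_2 : Baxter 2 = 2.
Proof. unfold Baxter, sum_f, Binomial.C; simpl; field. Qed.

(** In the recurrence [B_(n+2) / B_(n+1)] decreases as [B_(n+1) / B_n] increases, so the two bounds
    exchange roles in the induction: the old lower bound gives the new upper one and conversely. *)
Lemma Baxter_ratio (n : nat) : (1 <= n)%nat ->
  0 < Baxter n
  /\ 8 * INR n * Baxter n <= (INR n + 4) * Baxter (n + 1)
  /\ (INR n + 5) * Baxter (n + 1) <= 8 * (INR n + 1) * Baxter n.
Proof.
  induction 1 as [|n Hn [Hpos [Hlo Hhi]]].
  - change (1 + 1)%nat with 2%nat. rewrite Baxter_1, Baxter_2. simpl. lra.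
  - pose proof (Baxter_recurrence n Hn) as Hrec.
    replace (S n + 1)%nat with (n + 2)%nat by lia.
    replace (S n) with (n + 1)%nat by lia.
    rewrite plus_INR. simpl (INR 1).
    pose proof (le_INR 1 n Hn) as HN. simpl INR in HN.
    set (N := INR n) in *. set (a := Baxter n) in *.
    set (b := Baxter (n + 1)) in *. set (c := Baxter (n + 2)) in *.
    assert (Hb : 0 < b).
    { apply (Rmult_lt_reg_l (N + 4)); [lra|].
      rewrite Rmult_0_r. apply Rlt_le_trans with (8 * N * a); nra. }
    assert (Hup : 8 * N * (N + 1) * a <= (N + 1) * (N + 4) * b) by nra.
    assert (Hdn : N * (N + 5) * b <= 8 * N * (N + 1) * a) by nra.
    split; [exact Hb|split].
    + apply (Rmult_le_reg_l (N + 4)); [lra|].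
      replace ((N + 4) * ((N + 1 + 4) * c)) with ((N + 4) * (N + 5) * c) by ring.
      rewrite Hrec. nra.
    + apply (Rmult_le_reg_l ((N + 4) * (N + 5))); [nra|].
      replace ((N + 4) * (N + 5) * ((N + 1 + 5) * c))
        with ((N + 6) * ((N + 4) * (N + 5) * c)) by ring.
      rewrite Hrec.
      (* [Hup] bounds the last term by [(N^2 + 5 N + 4) b]. The two cubics compared below agree in
         their two leading coefficients, and the slack is [20 N + 56]. *)
      apply Rle_trans with ((N + 6) * (8 * N ^ 2 + 40 * N + 44) * b).
      * rewrite (Rmult_assoc (N + 6)). apply Rmult_le_compat_l; [lra|]. nra.
      * replace ((N + 4) * (N + 5) * (8 * (N + 1 + 1) * b))
          with ((N + 4) * (N + 5) * (8 * (N + 2)) * b) by ring.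
        apply Rmult_le_compat_r; [lra|]. nra.
Qed.

Lemma Baxter_pos (n : nat) : (1 <= n)%nat -> 0 < Baxter n.
Proof. intros Hn. apply (Baxter_ratio n Hn). Qed.

Lemma ln_minus (x y : R) : 0 < x -> 0 < y -> ln x - ln y = ln (x / y).
Proof.
  intros Hx Hy. unfold Rdiv.
  rewrite ln_mult, ln_Rinv by auto using Rinv_0_lt_compat. ring.
Qed.

Definition log_growth (n : nat) : R := ln (Baxter (n + 1)) - ln (Baxter n).

Lemma ln_le_ln (x y : R) : 0 < x -> x <= y -> ln x <= ln y.
Proof. intros Hx [H | ->]; [left; now apply ln_increasing|right; reflexivity]. Qed.

Lemma log_growth_bounds (n : nat) : (1 <= n)%nat ->
  ln (8 * INR n / (INR n + 4)) <= log_growth n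
     <= ln (8 * (INR n + 1) / (INR n + 5)).
Proof.
  intros Hn. destruct (Baxter_ratio n Hn) as [Ha [Hlo Hhi]].
  pose proof (Baxter_pos (n + 1) ltac:(lia)) as Hb.
  pose proof (le_INR 1 n Hn) as HN. simpl INR in HN.
  unfold log_growth. rewrite ln_minus by assumption.
  split; apply ln_le_ln.
  - apply Rdiv_lt_0_compat; lra.
  - apply Rmult_le_reg_r with (Baxter n * (INR n + 4)); [nra|].
    field_simplify; lra.
  - now apply Rdiv_lt_0_compat.
  - apply Rmult_le_reg_r with (Baxter n * (INR n + 5)); [nra|].
    field_simplify; lra.
Qed.

(** Since [exp (1/8) >= 9/8], [exp (3/4) >= (9/8)^6 > 2]. *)
Lemma ln_2_le : ln 2 <= 3 / 4.
Proof.
  rewrite <- (ln_exp (3 / 4)). apply ln_le_ln; [lra|].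
  pose proof (exp_ineq1_le (1 / 8)) as H.
  replace (3 / 4) with (1/8 + 1/8 + 1/8 + 1/8 + 1/8 + 1/8) by lra.
  rewrite !exp_plus.
  assert (H2 : (9/8) ^ 6 <= exp (1 / 8) ^ 6) by (apply pow_incr; lra).
  lra.
Qed.

Lemma log_growth_le_ln8 (n : nat) : (1 <= n)%nat -> log_growth n <= 3 * ln 2.
Proof.
  intros Hn. pose proof (pos_INR n).
  eapply Rle_trans; [apply log_growth_bounds; assumption|].
  replace (3 * ln 2) with (ln 8).
  - apply ln_le_ln; [apply Rdiv_lt_0_compat; lra|].
    apply Rmult_le_reg_r with (INR n + 5); [lra|]. field_simplify; lra.
  - replace 8 with (2 * 2 * 2) by ring. rewrite !ln_mult by lra. ring.
Qed.

(** The upper bound on the ratio at [n] coincides with the lower bound at [n + 1], whence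
    monotonicity. The quotient of the outer bounds is [1 + 8 / (n (n + 6))], and
    [ln (1 + z) <= z]. *)
Lemma log_growth_mono (n : nat) : (1 <= n)%nat ->
  log_growth n <= log_growth (n + 1)
  /\ log_growth (n + 1) - log_growth n <= 8 / (INR n * (INR n + 6)).
Proof.
  intros Hn. pose proof (le_INR 1 n Hn) as HN. simpl INR in HN.
  pose proof (log_growth_bounds n Hn) as [H1 H2].
  pose proof (log_growth_bounds (n + 1) ltac:(lia)) as [H3 H4].
  rewrite plus_INR in H3, H4. simpl (INR 1) in H3, H4.
  replace (INR n + 1 + 4) with (INR n + 5) in * by ring.
  replace (INR n + 1 + 5) with (INR n + 6) in * by ring.
  replace (INR n + 1 + 1) with (INR n + 2) in * by ring.
  split; [lra|].
  apply Rle_trans with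
    (ln (8 * (INR n + 2) / (INR n + 6)) - ln (8 * INR n / (INR n + 4))); [lra|].
  rewrite ln_minus by (apply Rdiv_lt_0_compat; lra).
  set (y := _ / _ / _).
  assert (Hy : y = 1 + 8 / (INR n * (INR n + 6))) by (unfold y; field; lra).
  rewrite Hy.
  set (z := 8 / (INR n * (INR n + 6))).
  assert (Hz : 0 < z) by (apply Rdiv_lt_0_compat; nra).
  rewrite <- (ln_exp z) at 2. apply ln_le_ln; [lra|]. apply exp_ineq1_le.
Qed.

Lemma ln_Baxter_lower (n : nat) : (1 <= n)%nat ->
  (INR n - 1) * ln 2 <= ln (Baxter n).
Proof.
  induction 1 as [|n Hn IH].
  - rewrite Baxter_1, ln_1. simpl. lra.
  - assert (Hg : ln 2 <= log_growth n).
    (* The ratio bound [8 n / (n + 4)] is at least 2 only from [n = 2] on; at [n = 1] the ratio is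
       exactly 2. *)
    { destruct (Nat.eq_dec n 1) as [-> | Hn1].
      - unfold log_growth. change (1 + 1)%nat with 2%nat.
        rewrite Baxter_1, Baxter_2, ln_1. lra.
      - pose proof (le_INR 2 n ltac:(lia)) as HN. simpl INR in HN.
        eapply Rle_trans; [|apply log_growth_bounds; assumption].
        apply ln_le_ln; [lra|].
        apply Rmult_le_reg_r with (INR n + 4); [lra|]. field_simplify; lra. }
    unfold log_growth in Hg. replace (n + 1)%nat with (S n) in Hg by lia.
    rewrite S_INR. lra.
Qed.

(* Log-convexity together with [Baxter 1 = 1]. *)
Lemma ln_Baxter_upper (n : nat) : (1 <= n)%nat ->
  ln (Baxter (n + 1)) <= (INR n + 1) * log_growth n.
Proof.
  induction 1 as [|n Hn IH].
  - unfold log_growth. change (1 + 1)%nat with 2%nat.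
    rewrite Baxter_1, Baxter_2, ln_1. simpl. pose proof ln_lt_2. lra.
  - replace (S n) with (n + 1)%nat by lia.
    assert (E : ln (Baxter (n + 1 + 1)) = ln (Baxter (n + 1)) + log_growth (n + 1))
      by (unfold log_growth; ring).
    rewrite E, plus_INR. simpl (INR 1).
    pose proof (log_growth_mono n Hn) as [Hm _]. pose proof (pos_INR n). nra.
Qed.

Definition log_root (n : nat) : R := ln (Baxter n) / INR n.

Definition log_root_diff2 (m : nat) : R :=
  log_root m + log_root (m + 2) - 2 * log_root (m + 1).

(** Here [n] is the middle index, and [n (n^2 - 1)] clears the denominators [m], [m + 1], [m + 2].
    What remains is [2 (ln B_n - n g) + n (n - 1) (g' - g)] with [g], [g'] the adjacent log growths:
    the first term is nonpositive and linear in size, the second lies between 0 and 8. *)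
Lemma log_root_diff2_bounds (m : nat) : (1 <= m)%nat ->
  let n := INR m + 1 in
  - (3 * n + 2) <= n * (n ^ 2 - 1) * log_root_diff2 m <= 8.
Proof.
  intros Hm n. unfold n. clear n.
  pose proof (le_INR 1 m Hm) as HM. simpl INR in HM.
  pose proof (ln_Baxter_lower (m + 1) ltac:(lia)) as Hlo.
  pose proof (ln_Baxter_upper m Hm) as Hhi.
  pose proof (log_growth_mono m Hm) as [Hm1 Hm2].
  pose proof (log_growth_le_ln8 m Hm) as H8.
  pose proof ln_2_le as Hln2.
  rewrite plus_INR in Hlo. simpl (INR 1) in Hlo.
  set (M := INR m) in *.
  set (g := log_growth m) in *. set (g' := log_growth (m + 1)) in *.
  set (l := ln (Baxter (m + 1))) in *.
  assert (E : (M + 1) * ((M + 1) ^ 2 - 1) * log_root_diff2 m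
    = 2 * (l - (M + 1) * g) + M * (M + 1) * (g' - g)).
  { unfold log_root_diff2, log_root.
    replace (ln (Baxter m)) with (l - g) by (unfold l, g, log_growth; ring).
    replace (ln (Baxter (m + 2))) with (l + g')
      by (unfold l, g', log_growth; replace (m + 1 + 1)%nat with (m + 2)%nat by lia; ring).
    fold l. rewrite !plus_INR. simpl (INR 1). simpl (INR 2). fold M.
    field. lra. }
  rewrite E. split.
  (* With [l >= (n - 1) ln 2], [g <= 3 ln 2] and [g' >= g], the expression is at least
     [-(4 n + 2) ln 2], and [ln 2 <= 3/4]. *)
  - nra.
  - assert (M * (M + 1) * (g' - g) <= 8).
    { apply Rle_trans with (M * (M + 1) * (8 / (M * (M + 6)))); [nra|].
      apply Rmult_le_reg_r with (M + 6); [lra|]. field_simplify; lra. }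
    lra.
Qed.

(** * The gap of two quotients and its sign for large indices *)

Definition turan_gap (u v : R) : R := 4 * (1 - u) * (1 - v) - (1 - u * v) ^ 2.

Lemma turan_expr_gap (c0 c1 c2 c3 : R) : c1 <> 0 -> c2 <> 0 ->
  4 * (c1 ^ 2 - c0 * c2) * (c2 ^ 2 - c1 * c3) - (c1 * c2 - c0 * c3) ^ 2
  = (c1 * c2) ^ 2 * turan_gap (c0 * c2 / c1 ^ 2) (c1 * c3 / c2 ^ 2).
Proof. intros H1 H2. unfold turan_gap. field. now split. Qed.

Lemma higher_order_Turan_gap (m : nat) (c : nat -> R) :
  (forall n : nat, (m <= n)%nat -> 0 < c n) ->
  (forall n : nat, (m <= n)%nat ->
     0 <= turan_gap (c n * c (n + 2)%nat / c (n + 1)%nat ^ 2)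
                    (c (n + 1)%nat * c (n + 3)%nat / c (n + 2)%nat ^ 2)) ->
  higher_order_Turan m c.
Proof.
  intros Hc Hgap n Hn.
  destruct (Nat.le_exists_sub (m + 1) n Hn) as [k [-> _]].
  replace (k + (m + 1) - 1)%nat with (k + m)%nat by lia.
  replace (k + (m + 1) + 1)%nat with (k + m + 2)%nat by lia.
  replace (k + (m + 1) + 2)%nat with (k + m + 3)%nat by lia.
  replace (k + (m + 1))%nat with (k + m + 1)%nat by lia.
  rewrite turan_expr_gap by (apply Rgt_not_eq, Hc; lia).
  apply Rle_ge, Rmult_le_pos; [apply pow2_ge_0|apply Hgap; lia].
Qed.

(** The upper bound comes from [exp e <= 1 / (1 - t)], which is at most [1 + 36/35 t] once
    [t <= 1/36]. The constant is chosen so that [36/35 * 7/2 = 36/10]. *)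
Lemma exp_near_1 (e t : R) : 0 <= t <= 1 / 100 -> - t <= e <= t ->
  1 - 36 / 35 * t <= exp e <= 1 + 36 / 35 * t.
Proof.
  intros Ht He. split.
  - pose proof (exp_ineq1_le e). lra.
  - pose proof (exp_ineq1_le (- e)) as H. pose proof (exp_pos e) as Hp.
    assert (Hinv : exp e * exp (- e) = 1)
      by (rewrite <- exp_plus; replace (e + - e) with 0 by ring; apply exp_0).
    assert (exp e * (1 - t) <= 1) by nra.
    apply Rmult_le_reg_r with (1 - t); [lra|]. nra.
Qed.

(* With [u = 1 - p] and [v = 1 - q] the gap equals
   [pq (2 (p + q) - pq) - (p - q)^2]; here [p] and [q] are [1/n + O(1/n^2)],
   so the two terms are of order [4/n^3] and [O(1/n^4)]. *)
Lemma turan_gap_asymptotic (n e e' : R) : 40 <= n ->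
  - (7 / 2 / n ^ 2) <= e <= 7 / 2 / n ^ 2 ->
  - (7 / 2 / n ^ 2) <= e' <= 7 / 2 / n ^ 2 ->
  0 <= turan_gap (n / (n + 1) * exp e) ((n + 1) / (n + 2) * exp e').
Proof.
  intros Hn He He'.
  set (h := / n).
  assert (Hh : 0 < h <= / 40).
  { split; [apply Rinv_0_lt_compat; lra|apply Rinv_le_contravar; lra]. }
  replace (7 / 2 / n ^ 2) with (7 / 2 * h ^ 2) in * by (unfold h; field; lra).
  apply exp_near_1 in He; [|nra]. apply exp_near_1 in He'; [|nra].
  assert (E1 : n / (n + 1) = / (1 + h)) by (unfold h; field; lra).
  assert (E2 : (n + 1) / (n + 2) = (1 + h) / (1 + 2 * h)) by (unfold h; field; lra).
  rewrite E1, E2.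
  set (a := / (1 + h)). set (b := (1 + h) / (1 + 2 * h)).
  assert (Ha : 1 - h <= a <= 1 - h + h ^ 2).
  { unfold a; split; apply Rmult_le_reg_r with (1 + h); try lra;
      rewrite Rinv_l by lra; nra. }
  assert (Hb : 1 - h + h ^ 2 <= b <= 1 - h + 2 * h ^ 2).
  { unfold b; split; apply Rmult_le_reg_r with (1 + 2 * h); try lra;
      unfold Rdiv; rewrite Rmult_assoc, Rinv_l by lra; nra. }
  set (A := exp e) in *. set (B := exp e') in *.
  (* The exponential contributes [36/10] on either side; the [h^2] term in the upper bound of [a],
     resp. [b] below, adds 1, resp. 2, to the lower bound. *)
  assert (Hp : h - 46 / 10 * h ^ 2 <= 1 - a * A <= h + 36 / 10 * h ^ 2).
  { split.
    - assert (a * A <= (1 - h + h ^ 2) * (1 + 36 / 35 * (7 / 2 * h ^ 2)))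
        by (apply Rmult_le_compat; nra).
      nra.
    - assert ((1 - h) * (1 - 36 / 35 * (7 / 2 * h ^ 2)) <= a * A)
        by (apply Rmult_le_compat; nra).
      nra. }
  assert (Hq : h - 56 / 10 * h ^ 2 <= 1 - b * B <= h + 36 / 10 * h ^ 2).
  { split.
    - assert (b * B <= (1 - h + 2 * h ^ 2) * (1 + 36 / 35 * (7 / 2 * h ^ 2)))
        by (apply Rmult_le_compat; nra).
      nra.
    - assert ((1 - h) * (1 - 36 / 35 * (7 / 2 * h ^ 2)) <= b * B)
        by (apply Rmult_le_compat; nra).
      nra. }
  set (p := 1 - a * A) in *. set (q := 1 - b * B) in *.
  replace (turan_gap (a * A) (b * B))
    with (p * q * (2 * (p + q) - p * q) - (p - q) ^ 2)
    by (unfold turan_gap, p, q; ring).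
  clearbody a b A B p q h.
  assert (Hp1 : 88 / 100 * h <= p <= 109 / 100 * h) by nra.
  assert (Hq1 : 86 / 100 * h <= q <= 109 / 100 * h) by nra.
  (* The linear terms cancel, and [36/10 + 56/10 = 92/10]. *)
  assert (Hd : (p - q) ^ 2 <= (92 / 10 * h ^ 2) ^ 2).
  { rewrite <- (Rsqr_pow2 (p - q)), <- (Rsqr_pow2 (_ * _)).
    apply Rsqr_le_abs_1. rewrite (Rabs_right (_ * _)) by nra.
    apply Rabs_le; lra. }
  assert (H1 : 75 / 100 * h ^ 2 <= p * q) by nra.
  assert (H2 : 34 / 10 * h <= 2 * (p + q) - p * q) by nra.
  assert (H3 : 75 / 100 * h ^ 2 * (34 / 10 * h) <= p * q * (2 * (p + q) - p * q))
    by (apply Rmult_le_compat; nra).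
  (* This amounts to [84.64 h <= 2.55], that is [n >= 34] for integers, which the cut-off 40
     meets. *)
  assert (H4 : (92 / 10 * h ^ 2) ^ 2 <= 75 / 100 * h ^ 2 * (34 / 10 * h)).
  { replace ((92 / 10 * h ^ 2) ^ 2) with (h ^ 3 * (8464 / 100 * h)) by field.
    replace (75 / 100 * h ^ 2 * (34 / 10 * h)) with (h ^ 3 * (255 / 100)) by field.
    apply Rmult_le_compat_l; [apply pow_le|]; lra. }
  lra.
Qed.

(** The asymmetry matters: a difference of two such values is at most [3.1 + 0.3 = 3.4] over [n^2],
    within the [7/2] that [turan_gap_asymptotic] allows, whereas a symmetric bound would give
    [6.2]. *)
Lemma log_root_diff2_small (m : nat) : (39 <= m)%nat ->
  let n := INR m + 1 in
  - (31 / 10 / n ^ 2) <= log_root_diff2 m <= 3 / 10 / n ^ 2.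
Proof.
  intros Hm n. pose proof (log_root_diff2_bounds m ltac:(lia)) as Hb.
  fold n in Hb. cbv zeta in Hb.
  pose proof (le_INR 39 m Hm) as HM.
  replace (INR 39) with 39 in HM by (simpl; lra).
  assert (Hn : 40 <= n) by (unfold n; lra). clearbody n.
  assert (Hc : 0 < n * (n ^ 2 - 1)) by nra.
  assert (Hn3 : 0 < n ^ 3) by (apply pow_lt; lra).
  split; apply Rmult_le_reg_l with (n * (n ^ 2 - 1)); try exact Hc.
  - apply Rle_trans with (- (3 * n + 2)); [|lra].
    apply Rmult_le_reg_r with n; [lra|]. field_simplify; [|lra].
    apply Rmult_le_reg_r with 10; [lra|]. field_simplify. nra.
  - apply Rle_trans with 8; [lra|].
    apply Rmult_le_reg_r with n; [lra|]. field_simplify; [|lra].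
    apply Rmult_le_reg_r with 10; [lra|]. field_simplify. nra.
Qed.

(** * Roots of the Baxter numbers and their quotients *)

Definition baxter_root (n : nat) : R := nth_root n (Baxter n).

Lemma baxter_root_exp (n : nat) : baxter_root n = exp (log_root n).
Proof. unfold baxter_root, nth_root, Rpower, log_root. f_equal. apply Rmult_comm. Qed.

Lemma baxter_root_pos (n : nat) : 0 < baxter_root n.
Proof. rewrite baxter_root_exp. apply exp_pos. Qed.

Definition root_quotient (m : nat) : R :=
  baxter_root m * baxter_root (m + 2) / baxter_root (m + 1) ^ 2.

Lemma root_quotient_exp (m : nat) : root_quotient m = exp (log_root_diff2 m).
Proof.
  unfold root_quotient, log_root_diff2. rewrite !baxter_root_exp.
  replace (2 * log_root (m + 1)) with (log_root (m + 1) + log_root (m + 1)) by ring.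
  unfold Rminus, Rdiv. rewrite !exp_plus, exp_Ropp, exp_plus.
  simpl. now rewrite Rmult_1_r.
Qed.

(** * Rational enclosures for the small indices *)

(* The pair [(B_(k+1), B_(k+2))]; the division is exact, which is only
   checked on the range of indices that is used. *)
Fixpoint baxter_pair (k : nat) : Z * Z :=
  match k with
  | O => (1, 2)%Z
  | S k' =>
      let (a, b) := baxter_pair k' in
      let n := Z.of_nat k in
      (b, ((7 * n ^ 2 + 35 * n + 40) * b + 8 * n * (n + 1) * a)
            / ((n + 4) * (n + 5)))%Z
  end.

Definition baxter_step_exact (k : nat) : bool :=
  let (a, b) := baxter_pair k in
  let n := Z.of_nat (S k) in
  ((n + 4) * (n + 5) * snd (baxter_pair (S k))
   =? (7 * n ^ 2 + 35 * n + 40) * b + 8 * n * (n + 1) * a)%Z.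

Lemma baxter_pair_correct (K : nat) :
  forallb baxter_step_exact (seq 0 K) = true ->
  forall k : nat, (k <= K)%nat ->
    Baxter (k + 1) = IZR (fst (baxter_pair k))
    /\ Baxter (k + 2) = IZR (snd (baxter_pair k)).
Proof.
  intros Hex k. rewrite forallb_forall in Hex.
  induction k as [|k IH]; intros Hk.
  - split; [apply Baxter_1|apply Baxter_2].
  - destruct (IH ltac:(lia)) as [Ha Hb]. clear IH.
    specialize (Hex k ltac:(apply in_seq; lia)).
    unfold baxter_step_exact in Hex.
    replace (S k + 1)%nat with (k + 2)%nat by lia.
    pose proof (Baxter_recurrence (k + 1) ltac:(lia)) as Hrec.
    replace (k + 1 + 2)%nat with (S k + 2)%nat in Hrec by lia.
    replace (k + 1 + 1)%nat with (k + 2)%nat in Hrec by lia.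
    assert (Hfst : fst (baxter_pair (S k)) = snd (baxter_pair k))
      by (cbn [baxter_pair]; now destruct (baxter_pair k)).
    rewrite Hfst. split; [exact Hb|].
    destruct (baxter_pair k) as [a b]. cbn [fst snd] in *.
    apply Z.eqb_eq in Hex. apply (f_equal IZR) in Hex.
    rewrite Ha, Hb, INR_IZR_INZ in Hrec.
    replace (k + 1)%nat with (S k) in Hrec by lia.
    set (n := Z.of_nat (S k)) in *.
    set (z := snd (baxter_pair (S k))) in *. clearbody z.
    rewrite Z.pow_2_r in Hex.
    repeat rewrite ?plus_IZR, ?mult_IZR in Hex.
    assert (Hn : 0 <= IZR n) by (apply IZR_le; unfold n; lia).
    apply Rmult_eq_reg_l with ((IZR n + 4) * (IZR n + 5)).
    + rewrite Hrec. rewrite Hex. ring.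
    + apply Rgt_not_eq; nra.
Qed.

(** Requiring a positive lower endpoint makes products and quotients monotone, so that they can be
    computed endpoint by endpoint. *)
Definition in_itv (I : Q * Q) (x : R) : Prop :=
  0 < Q2R (fst I) /\ Q2R (fst I) <= x <= Q2R (snd I).

Definition itv_mul (I J : Q * Q) : Q * Q :=
  (fst I * fst J, snd I * snd J)%Q.

Definition itv_div (I J : Q * Q) : Q * Q :=
  (fst I / snd J, snd I / fst J)%Q.

Lemma Q2R_div_pos (p q : Q) : 0 < Q2R q -> Q2R (p / q) = Q2R p / Q2R q.
Proof.
  intros Hq. apply Q2R_div. intros H. apply Qeq_eqR in H.
  rewrite H in Hq. unfold Q2R in Hq. simpl in Hq. lra.
Qed.

Lemma in_itv_mul (I J : Q * Q) (x y : R) :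
  in_itv I x -> in_itv J y -> in_itv (itv_mul I J) (x * y).
Proof.
  unfold in_itv, itv_mul; cbn [fst snd]. intros [HI [HI1 HI2]] [HJ [HJ1 HJ2]].
  rewrite !Q2R_mult. split; [now apply Rmult_lt_0_compat|].
  split; apply Rmult_le_compat; lra.
Qed.

Lemma in_itv_div (I J : Q * Q) (x y : R) :
  in_itv I x -> in_itv J y -> in_itv (itv_div I J) (x / y).
Proof.
  unfold in_itv, itv_div; cbn [fst snd]. intros [HI [HI1 HI2]] [HJ [HJ1 HJ2]].
  rewrite !Q2R_div_pos by lra.
  split; [apply Rdiv_lt_0_compat; lra|].
  split; apply Rmult_le_compat; try lra;
    try (apply Rlt_le, Rinv_0_lt_compat; lra);
    apply Rinv_le_contravar; lra.
Qed.

Definition gap_check (U V : Q * Q) : bool :=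
  (Qle_bool (snd U) 1 && Qle_bool (snd V) 1
   && Qle_bool ((1 - fst U * fst V) * (1 - fst U * fst V))
               (4 * (1 - snd U) * (1 - snd V)))%Q.

(** On [u, v <= 1] the product [4 (1 - u) (1 - v)] is smallest at the upper endpoints and
    [(1 - u v)^2] largest at the lower ones; the check compares these worst cases. *)
Lemma gap_check_correct (U V : Q * Q) (u v : R) :
  in_itv U u -> in_itv V v -> gap_check U V = true -> 0 <= turan_gap u v.
Proof.
  intros [HU [HU1 HU2]] [HV [HV1 HV2]] H.
  unfold gap_check in H.
  apply andb_prop in H as [H H3]. apply andb_prop in H as [H1 H2].
  apply Qle_bool_iff, Qle_Rle in H1, H2, H3.
  rewrite !Q2R_mult, !Q2R_minus, !Q2R_mult in H3.
  rewrite RMicromega.Q2R_1 in *.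
  replace (Q2R 4) with 4 in H3 by (unfold Q2R; simpl; field).
  unfold turan_gap.
  assert (Q2R (fst U) * Q2R (fst V) <= u * v) by (apply Rmult_le_compat; lra).
  assert (u * v <= 1) by nra.
  assert ((1 - u * v) ^ 2
    <= (1 - Q2R (fst U) * Q2R (fst V)) * (1 - Q2R (fst U) * Q2R (fst V))) by nra.
  assert (4 * (1 - Q2R (snd U)) * (1 - Q2R (snd V)) <= 4 * (1 - u) * (1 - v))
    by nra.
  lra.
Qed.

Definition index_itv (k : nat) : Q * Q :=
  let q := (Z.of_nat k # Pos.of_nat (k + 1))%Q in (q, q).

Lemma in_index_itv (k : nat) : (1 <= k)%nat ->
  in_itv (index_itv k) (INR k / (INR k + 1)).
Proof.
  intros Hk. pose proof (le_INR 1 k Hk) as HK. simpl INR in HK.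
  assert (E : Q2R (Z.of_nat k # Pos.of_nat (k + 1)) = INR k / (INR k + 1)).
  { unfold Q2R; cbn [Qnum Qden]. rewrite <- INR_IZR_INZ.
    rewrite <- positive_nat_Z, <- INR_IZR_INZ, Nat2Pos.id by lia.
    rewrite plus_INR. reflexivity. }
  unfold in_itv, index_itv; cbn [fst snd]. rewrite E.
  split; [apply Rdiv_lt_0_compat; lra|lra].
Qed.

Definition root_scale : positive := 65536.

(* Entry [n - 1] is the integer part of [2^16 B_n^(1/n)]. *)
Definition root_table : list Z :=
  [65536; 92681; 119086; 141933; 161896; 179486; 195123; 209134;
     221777; 233256; 243736; 253350; 262210; 270406; 278016; 285104;
     291727; 297931; 303757; 309242; 314416; 319307; 323939; 328333;
     332508; 336481; 340268; 343881; 347334; 350638; 353801; 356835;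
     359746; 362544; 365233; 367822; 370316; 372721; 375040; 377280;
     379444; 381537]%Z.

Definition scaled_root (n : nat) : Z := nth (n - 1) root_table 0%Z.

Definition root_itv (n : nat) : Q * Q :=
  let r := scaled_root n in (r # root_scale, r + 1 # root_scale)%Q.

(** Integer form of [r / s <= B_n^(1/n) <= (r + 1) / s]: both sides are raised to the power [n] and
    multiplied by [s^n]. The table thus needs no justification of its own. *)
Definition root_check (n : nat) : bool :=
  let N := Z.of_nat n in
  let b := (fst (baxter_pair (n - 1)) * Z.pos root_scale ^ N)%Z in
  let r := scaled_root n in
  ((0 <? r) && (r ^ N <=? b) && (b <=? (r + 1) ^ N))%Z.

Lemma baxter_step_exact_small : forallb baxter_step_exact (seq 0 41) = true.
Proof. vm_cast_no_check (eq_refl true). Qed.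

Lemma root_check_small : forallb root_check (seq 1 42) = true.
Proof. vm_cast_no_check (eq_refl true). Qed.

Lemma baxter_root_pow (n : nat) : (1 <= n)%nat -> baxter_root n ^ n = Baxter n.
Proof.
  intros Hn. rewrite <- Rpower_pow by apply baxter_root_pos.
  unfold baxter_root, nth_root. rewrite Rpower_mult, Rinv_l.
  - apply Rpower_1. now apply Baxter_pos.
  - apply not_0_INR. lia.
Qed.

Lemma in_scaled_itv (n : nat) (b r : Z) (s : positive) : (1 <= n)%nat ->
  Baxter n = IZR b -> (0 < r)%Z ->
  (r ^ Z.of_nat n <= b * Z.pos s ^ Z.of_nat n)%Z ->
  (b * Z.pos s ^ Z.of_nat n <= (r + 1) ^ Z.of_nat n)%Z ->
  in_itv (r # s, r + 1 # s) (baxter_root n).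
Proof.
  intros Hn HB H1 H2 H3.
  apply IZR_lt in H1. apply IZR_le in H2, H3.
  rewrite mult_IZR, <- HB, <- !pow_IZR in H2, H3.
  rewrite <- (baxter_root_pow n Hn), <- Rpow_mult_distr in H2, H3.
  pose proof (baxter_root_pos n) as Hx.
  assert (Hs : 0 < IZR (Z.pos s)) by (apply IZR_lt; reflexivity).
  assert (Hroot : forall y z : R, 0 <= y -> 0 < z -> y ^ n <= z ^ n -> y <= z).
  { intros y z Hy Hz Hyz. destruct (Rle_lt_dec y z) as [|Hlt]; [assumption|].
    exfalso. apply (Rlt_not_le (y ^ n) (z ^ n)); [|exact Hyz].
    rewrite <- !Rpower_pow by lra. apply Rlt_Rpower_l; [apply lt_0_INR; lia|lra]. }
  apply Hroot in H2; [|lra|nra].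
  apply Hroot in H3; [|nra|rewrite plus_IZR; lra].
  rewrite plus_IZR in H3.
  unfold in_itv, Q2R; cbn [fst snd Qnum Qden].
  split; [apply Rdiv_lt_0_compat; lra|].
  rewrite plus_IZR.
  split; apply Rmult_le_reg_r with (IZR (Z.pos s)); try exact Hs;
    rewrite Rmult_assoc, Rinv_l by lra; lra.
Qed.

Lemma in_root_itv (n : nat) : (1 <= n)%nat ->
  Baxter n = IZR (fst (baxter_pair (n - 1))) ->
  root_check n = true -> in_itv (root_itv n) (baxter_root n).
Proof.
  intros Hn. unfold root_check, root_itv. cbv zeta.
  generalize (fst (baxter_pair (n - 1))) (scaled_root n) root_scale.
  intros b r s HB Hc.
  apply andb_prop in Hc as [Hc H3]. apply andb_prop in Hc as [H1 H2].
  apply Z.ltb_lt in H1. apply Z.leb_le in H2, H3.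
  now apply in_scaled_itv with b.
Qed.

Definition quotient_itv (m : nat) : Q * Q :=
  let J := root_itv (m + 1) in
  itv_div (itv_mul (root_itv m) (root_itv (m + 2))) (itv_mul J J).

Lemma quotient_itvs_correct :
  forall m : nat, (1 <= m <= 40)%nat -> in_itv (quotient_itv m) (root_quotient m).
Proof.
  intros m Hm.
  (* Quotients up to index 40 involve roots up to 42, and [B_n] is read from
     [baxter_pair (n - 1)]. *)
  assert (Hpair := baxter_pair_correct 41 baxter_step_exact_small).
  pose proof root_check_small as Hchk.
  rewrite forallb_forall in Hchk.
  assert (Hin : forall n : nat, (1 <= n <= 42)%nat ->
    in_itv (root_itv n) (baxter_root n)).
  { intros n Hn. apply in_root_itv; [lia| |apply Hchk, in_seq; lia].
    destruct (Hpair (n - 1)%nat ltac:(lia)) as [H _].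
    now replace (n - 1 + 1)%nat with n in H by lia. }
  unfold quotient_itv, root_quotient. cbv zeta.
  replace (baxter_root (m + 1) ^ 2)
    with (baxter_root (m + 1) * baxter_root (m + 1)) by ring.
  apply in_itv_div; apply in_itv_mul; apply Hin; lia.
Qed.

Definition small_check (m : nat) : bool :=
  let w0 := quotient_itv m in
  let w1 := quotient_itv (m + 1) in
  let w2 := quotient_itv (m + 2) in
  let s1 := index_itv (m + 1) in
  let s2 := index_itv (m + 2) in
  gap_check (itv_mul s1 w0) (itv_mul s2 w1)
  && gap_check (itv_mul s1 (itv_div w1 w0)) (itv_mul s2 (itv_div w2 w1)).

(** The range is [m = 2, ..., 38]; the last check uses the quotient of index 40, hence the last
    table entry, of index 42. *)
Lemma small_check_true : forallb small_check (seq 2 37) = true.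
Proof. vm_cast_no_check (eq_refl true). Qed.

(** * Both gaps for all indices, and the two sequences *)

Definition successor_ratio (m : nat) : R := INR m / (INR m + 1).

Lemma root_gap_nonneg (m : nat) : (2 <= m)%nat ->
  0 <= turan_gap (successor_ratio (m + 1) * root_quotient m)
                 (successor_ratio (m + 2) * root_quotient (m + 1))
  /\ 0 <= turan_gap
      (successor_ratio (m + 1) * (root_quotient (m + 1) / root_quotient m))
      (successor_ratio (m + 2) * (root_quotient (m + 2) / root_quotient (m + 1))).
Proof.
  intros Hm. unfold successor_ratio.
  destruct (Nat.le_gt_cases m 38) as [Hsmall | Hlarge].
  - pose proof small_check_true as Hc. rewrite forallb_forall in Hc.
    specialize (Hc m ltac:(apply in_seq; lia)).
    apply andb_prop in Hc as [Hc1 Hc2].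
    pose proof (quotient_itvs_correct m ltac:(lia)) as I0.
    pose proof (quotient_itvs_correct (m + 1) ltac:(lia)) as I1.
    pose proof (quotient_itvs_correct (m + 2) ltac:(lia)) as I2.
    pose proof (in_index_itv (m + 1) ltac:(lia)) as J1.
    pose proof (in_index_itv (m + 2) ltac:(lia)) as J2.
    split; eapply gap_check_correct.
    3: exact Hc1. 5: exact Hc2.
    all: auto using in_itv_mul, in_itv_div.
  - pose proof (log_root_diff2_small m ltac:(lia)) as D0.
    pose proof (log_root_diff2_small (m + 1) ltac:(lia)) as D1.
    pose proof (log_root_diff2_small (m + 2) ltac:(lia)) as D2.
    cbv zeta in D0, D1, D2.
    rewrite !root_quotient_exp. unfold Rdiv at 4 6.
    rewrite <- !exp_Ropp, <- !exp_plus.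
    rewrite !plus_INR in *. simpl (INR 1) in *. simpl (INR 2) in *.
    replace (INR m + (1 + 1)) with (INR m + 1 + 1) in * by ring.
    pose proof (le_INR 39 m ltac:(lia)) as HM.
    replace (INR 39) with 39 in HM by (simpl; lra).
    assert (Hn : 40 <= INR m + 1) by lra.
    set (n := INR m + 1) in *.
    replace (n + 1 + 1) with (n + 2) in * by ring.
    (* The three second differences are centred at [n], [n + 1], [n + 2]; all their bounds are
       relaxed to multiples of [1 / n^2]. *)
    assert (H0 : 0 < / n ^ 2) by (apply Rinv_0_lt_compat; nra).
    assert (H1 : 0 < / (n + 1) ^ 2 <= / n ^ 2)
      by (split; [apply Rinv_0_lt_compat|apply Rinv_le_contravar]; nra).
    assert (H2 : 0 < / (n + 2) ^ 2 <= / n ^ 2)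
      by (split; [apply Rinv_0_lt_compat|apply Rinv_le_contravar]; nra).
    unfold Rdiv in D0, D1, D2.
    split; apply turan_gap_asymptotic; try exact Hn; unfold Rdiv; lra.
Qed.

Theorem theorem2p5 :
  higher_order_Turan 2
    (fun n : nat => nth_root n (Baxter n) / INR (fact n))
  /\
  higher_order_Turan 2
    (fun n : nat => nth_root (n + 1) (Baxter (n + 1))
                    / (nth_root n (Baxter n) * INR (fact n))).
Proof.
  pose proof baxter_root_pos as Hpos. pose proof INR_fact_lt_0 as Hf.
  assert (Hpos0 : forall k : nat, baxter_root k <> 0)
    by (intros k; apply Rgt_not_eq, Hpos).
  assert (Hs : forall k : nat, INR k + 1 <> 0)
    by (intros k; pose proof (pos_INR k); lra).
  assert (Hs2 : forall k : nat, INR k + 1 + 1 <> 0)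
    by (intros k; pose proof (pos_INR k); lra).
  split; apply higher_order_Turan_gap; intros n Hn;
    repeat change (nth_root ?k (Baxter ?k)) with (baxter_root k).
  - now apply Rdiv_lt_0_compat.
  (* The factorials contribute [(k + 1)!^2 / (k! (k + 2)!) = (k + 1) / (k + 2)]. *)
  - assert (E : forall k : nat,
      baxter_root k / INR (fact k)
        * (baxter_root (k + 2) / INR (fact (k + 2)))
        / (baxter_root (k + 1) / INR (fact (k + 1))) ^ 2
      = successor_ratio (k + 1) * root_quotient k).
    { intros k. unfold successor_ratio, root_quotient.
      replace (fact (k + 2)) with (fact (S (S k))) by (f_equal; lia).
      replace (fact (k + 1)) with (fact (S k)) by (f_equal; lia).
      rewrite !INR_fact_succ, plus_INR, S_INR. simpl (INR 1).
      field. repeat split; auto using INR_fact_neq_0. }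
    pose proof (E (n + 1)%nat) as E1.
    replace (n + 1 + 2)%nat with (n + 3)%nat in E1 by lia.
    replace (n + 1 + 1)%nat with (n + 2)%nat in E1 by lia.
    rewrite E, E1. now apply root_gap_nonneg.
  - apply Rdiv_lt_0_compat; [|apply Rmult_lt_0_compat]; auto.
  (* Without the factorials this sequence consists of ratios of consecutive roots, so its quotients
     are ratios of consecutive root quotients. *)
  - assert (E : forall k : nat,
      baxter_root (k + 1) / (baxter_root k * INR (fact k))
        * (baxter_root (k + 3) / (baxter_root (k + 2) * INR (fact (k + 2))))
        / (baxter_root (k + 2) / (baxter_root (k + 1) * INR (fact (k + 1)))) ^ 2
      = successor_ratio (k + 1) * (root_quotient (k + 1) / root_quotient k)).
    { intros k. unfold successor_ratio, root_quotient.
      replace (fact (k + 2)) with (fact (S (S k))) by (f_equal; lia).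
      replace (fact (k + 1)) with (fact (S k)) by (f_equal; lia).
      replace (k + 1 + 2)%nat with (k + 3)%nat by lia.
      replace (k + 1 + 1)%nat with (k + 2)%nat by lia.
      rewrite !INR_fact_succ, plus_INR, S_INR. simpl (INR 1).
      field. repeat split; auto using INR_fact_neq_0. }
    pose proof (E n) as E0. pose proof (E (n + 1)%nat) as E1.
    replace (n + 1 + 3)%nat with (n + 3 + 1)%nat in E1 by lia.
    replace (n + 1 + 2)%nat with (n + 3)%nat in E1 by lia.
    replace (n + 1 + 1)%nat with (n + 2)%nat in E1 by lia.
    replace (n + 2 + 1)%nat with (n + 3)%nat by lia.
    replace (n + 1 + 1)%nat with (n + 2)%nat by lia.
    rewrite E0, E1. now apply root_gap_nonneg.
Qed.
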